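(* Let $c\in\mathbb{R}_{>0}$ and let $H=(V,\mathcal{E})$ be a finite hypergraph with the Hereditary Linear Delaunay property with parameter $c$. Then $\chi^2_{CF}(H^{\cup})=O(c\log|V|)$, with an absolute implied constant.
   Context: A hypergraph $H=(V,\mathcal{E})$ consists of a finite vertex set $V$ and a family $\mathcal{E}\subseteq 2^V$. For $V'\subseteq V$, $H[V']=(V',\{h\cap V' : h\in\mathcal{E}\})$. The Delaunay graph of $H$ is $\mathrm{Del}(H)=(V,\{h\in\mathcal{E}: |h|=2\})$. $H$ has the Hereditary Linear Delaunay property with parameter $c$ if for every $V'\subseteq V$ the graph $\mathrm{Del}(H[V'])$ has at most $c|V'|$ edges. $H^{\cup}$ denotes the hypergraph $(V,\{e\cup f : e,f\in\mathcal{E}\})$. A $2$-subset-CF-colouring of a hypergraph $(V,\mathcal{F})$ with $k$ colours is a function $\varphi$ from the set $\binom{V}{2}$ of $2$-element subsets of $V$ to a $k$-element set such that every $h\in\mathcal{F}$ with $|h|>2$ contains a pair $s\in\binom{h}{2}$ with $\varphi(s)\neq\varphi(s')$ for all $s'\in\binom{h}{2}\setminus\{s\}$; $\chi^2_{CF}$ is the least such $k$.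
   Formalization: The bound is proved as max(1, C·c·log|V|) with C absolute: for |V|=2 with no edges and c→0, one colour is needed while c·log|V|→0, so the literal bound fails; for c≥1/2 and |V|≥2 the maximum is absorbed by the constant. *)

(* Defs.v *)
From HB Require Import structures.
From mathcomp Require Import all_boot all_order all_algebra.
From mathcomp Require Import reals.

Set Implicit Arguments.
Unset Strict Implicit.
Unset Printing Implicit Defensive.

Import Order.TTheory GRing.Theory Num.Theory.

Record hypergraph (T : finType) := Hypergraph {
  vertices : {set T};
  edges : {set {set T}};
  edges_sub : edges \subset powerset vertices
}.

Definition pairs (T : finType) (A : {set T}) : {set {set T}} :=
  [set s in powerset A | #|s| == 2].

Section Operations.
Variables (T : finType) (H : hypergraph T).

Fact induced_sub (V' : {set T}) :
  [set h :&: V' | h in edges H] \subset powerset V'.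
Proof.
by apply/fintype.subsetP => _ /imsetP[h _ ->]; rewrite powersetE subsetIr.
Qed.

(* $H[V']$ *)
Definition induced (V' : {set T}) : hypergraph T :=
  Hypergraph (induced_sub V').

Fact Del_sub : [set h in edges H | #|h| == 2] \subset powerset (vertices H).
Proof.
by apply: fintype.subset_trans (edges_sub H); apply/fintype.subsetP => h;
   rewrite inE => /andP[].
Qed.

Definition Del : hypergraph T := Hypergraph Del_sub.

Fact union_sub :
  [set e :|: f | e in edges H, f in edges H] \subset powerset (vertices H).
Proof.
have sub := fintype.subsetP (edges_sub H).
apply/fintype.subsetP => _ /imset2P[e f /sub eV /sub fV ->].
by rewrite powersetE subUset -!powersetE eV.
Qed.

(* $H^\cup$; the case $e = f$ is allowed, so it contains the edges of $H$. *)
Definition union_hypergraph : hypergraph T := Hypergraph union_sub.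

(* The domain of a colouring is exactly $\binom{V}{2}$, so no colour is needed
   when $|V| < 2$, and at least one is needed otherwise. *)
Definition vpair : Type := {s : {set T} | s \in pairs (vertices H)}.

Definition subset2_CF (k : nat) (phi : {ffun vpair -> 'I_k}) : bool :=
  [forall h in edges H, (2 < #|h|) ==>
    [exists s : vpair, (val s \in pairs h) &&
      [forall s' : vpair, (val s' \in pairs h) && (s' != s) ==>
        (phi s != phi s')]]].

Definition subset2_CF_colourable (k : nat) : bool :=
  [exists phi : {ffun vpair -> 'I_k}, subset2_CF phi].

Fact subset2_CF_ex : exists k, subset2_CF_colourable k.
Proof.
exists #|{: vpair}|; apply/existsP; exists [ffun s => enum_rank s].
apply/forall_inP => h hE; apply/implyP => h2.
have hV : h \subset vertices H.
  by rewrite -powersetE; apply: (fintype.subsetP (edges_sub H)).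
have /card_gt1P[x [y [xh yh xy]]] := ltnW h2.
have sh : [set x; y] \in pairs h.
  by rewrite inE powersetE cards2 xy subUset !sub1set xh yh.
have sV : [set x; y] \in pairs (vertices H).
  by move: sh; rewrite !inE => /andP[/fintype.subset_trans-> // ->].
apply/existsP; exists (Sub [set x; y] sV); rewrite SubK sh /=.
apply/forallP => s'; apply/implyP => /andP[_ ne].
by rewrite !ffunE (inj_eq enum_rank_inj) eq_sym.
Qed.

(* $\chi^2_{CF}(H)$ *)
Definition chi2_CF : nat := ex_minn subset2_CF_ex.

End Operations.

Local Open Scope ring_scope.

Definition hereditary_linear_Delaunay (R : realType) (T : finType)
    (c : R) (H : hypergraph T) : Prop :=
  forall V' : {set T}, V' \subset vertices H ->
    #|edges (Del (induced H V'))|%:R <= c * #|V'|%:R.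

(* Main.v *)
(* Call a pair short in W if it lies in a trace e n W of size at most 3.  A
   uniformly random subset S of W meets such a trace exactly in the given pair
   with probability at least 1/8, so averaging the Delaunay hypothesis over S
   bounds the number of short pairs by 8c|W|.  The graph of short pairs is thus
   O(c)-degenerate and a greedy colouring with O(c) colours makes traces of size
   at most 3 rainbow; larger traces then keep two points outside each colour
   class.  Peeling off the largest class O(c log |V|) times ranks the vertices so
   that in each edge the two lowest occupied ranks are attained only once.  In a
   union of two edges the colour of a pair, namely its maximal rank together
   with whether both ranks agree, then singles out a pair of low rank. *)
Require Import Defs.
From mathcomp Require Import all_boot all_order all_algebra.
From mathcomp Require Import reals sequences exp.
From mathcomp Require Import zify ring lra.

Import Order.TTheory GRing.Theory Num.Theory.

Set Implicit Arguments.
Unset Strict Implicit.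
Unset Printing Implicit Defensive.

(** * Short pairs, and ranking the vertices by peeling colour classes *)

Lemma card_split (T : finType) (A : {set T}) (P : pred T) :
  #|[set x in A | P x]| + #|[set x in A | ~~ P x]| = #|A|.
Proof.
rewrite -(cardsID [set x | P x] A); congr (_ + _); apply: eq_card => x.
  by rewrite !inE.
by rewrite !inE andbC.
Qed.

Section Ranking.
Variables (T : finType) (E : {set {set T}}).
Implicit Types (W e h s : {set T}).

Definition short_pairs W : {set {set T}} :=
  [set s in pairs W | [exists e in E, (s \subset e) && (#|e :&: W| <= 3)]].

(** Every [X :|: s] with [X] inside [W] minus [e] is such an [S], and distinct [X] give distinct
    sets; only the at most 3 points of [e :&: W] are prescribed, which costs a factor of at most
    [2 ^ 3]. *)
Lemma card_restricting_subsets W e s :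
  s \subset e :&: W -> #|e :&: W| <= 3 ->
  2 ^ #|W| <= 8 * #|[set S in powerset W | e :&: S == s]|.
Proof.
move=> sB B3; set B := e :&: W.
have BW : B \subset W by apply: subsetIr.
have eW : #|W| = #|W :\: B| + #|B|.
  by rewrite -(cardsID B W) (setIidPr BW) addnC.
have recover (Z : {set T}) : Z \subset W :\: B -> Z = (Z :|: s) :\: B.
  move=> ZW; apply/setP => x; rewrite !inE.
  have /implyP := fintype.subsetP ZW x; have /implyP := fintype.subsetP sB x.
  rewrite !inE.
  by case: (x \in Z) (x \in s) (x \in e) (x \in W) => [] [] [] [].
have inj : {in powerset (W :\: B) &, injective (fun X => X :|: s)}.
  move=> X Y; rewrite !powersetE => XW YW XY.
  by rewrite (recover X XW) (recover Y YW) XY.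
have img : [set X :|: s | X in powerset (W :\: B)]
    \subset [set S in powerset W | e :&: S == s].
  apply/fintype.subsetP => _ /imsetP[X XW ->]; move: XW; rewrite powersetE => XW.
  rewrite inE powersetE; apply/andP; split.
    rewrite subUset (fintype.subset_trans XW (subsetDl _ _)).
    exact: fintype.subset_trans sB BW.
  apply/eqP/setP => x; rewrite !inE.
  have /implyP := fintype.subsetP XW x; have /implyP := fintype.subsetP sB x.
  rewrite !inE.
  by case: (x \in X) (x \in s) (x \in e) (x \in W) => [] [] [] [].
have := subset_leq_card img; rewrite card_in_imset // card_powerset => le.
rewrite eW expnD mulnC; apply: leq_mul => //.
by apply: (@leq_trans (2 ^ 3)) => //; rewrite leq_pexp2l.
Qed.

(** The degrees sum to twice the number of short pairs, so they cannot all exceed [D]. *)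
Lemma low_degree_vertex (D : nat) W :
  W != set0 -> 2 * #|short_pairs W| < D.+1 * #|W| ->
  exists2 v, v \in W & #|[set s in short_pairs W | v \in s]| <= D.
Proof.
move=> W0 lt; case: (pickP [pred v in W |
    #|[set s in short_pairs W | v \in s]| <= D]) => [v /andP[vW vD]|noV].
  by exists v.
move: lt; rewrite ltnNge => /negP[].
rewrite mulnC -sum_nat_const.
apply: (@leq_trans (\sum_(v in W) #|[set s in short_pairs W | v \in s]|)).
  by apply: leq_sum => v vW; have := noV v; rewrite /= vW /= ltnNge => ->.
under eq_bigr => v _.
  rewrite -sum1_card; under eq_bigl => s do rewrite inE.
  rewrite big_mkcondr; over.
rewrite exchange_big /= mulnC -sum_nat_const; apply: leq_sum => s.
rewrite 2!inE powersetE => /andP[/andP[sW /eqP <-] _].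
rewrite -big_mkcondr /= sum1_card; apply/subset_leq_card/fintype.subsetP => v.
by case/andP.
Qed.

(* The condition allowing class [i] to be ranked above the rest of [W]: if two
   points of [e] get the same rank, two points of [e] are ranked below them. *)
Definition peelable (I : eqType) W (f : T -> I) e i :=
  (#|[set x in e :&: W | f x == i]| <= 1)
    || (1 < #|[set x in e :&: W | f x != i]|).

(** Greedy colouring along a degeneracy order: remove a vertex [v] of low degree, colour the rest,
    then give [v] a colour absent from its short neighbours. The induction carries [peelable]
    itself, which can only be threatened when few points of [e] remain. *)
Lemma peelable_colouring (D : nat) W :
  (forall W', W' \subset W -> 2 * #|short_pairs W'| <= D * #|W'|) ->
  exists f : T -> 'I_D.+1, forall e i, e \in E -> peelable W f e i.
Proof.
have [n leWn] := ubnP #|W|; elim: n => // n IH in W leWn *.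
move=> sparse.
have [->|W0] := eqVneq W set0.
  exists (fun=> ord0) => e i _; rewrite /peelable setI0.
  rewrite (_ : [set x in set0 | _] = set0) ?cards0 //.
  by apply/setP => x; rewrite !inE.
have W1 : 0 < #|W| by rewrite card_gt0.
have [|v vW degv] := @low_degree_vertex D W W0.
  by rewrite (leq_ltn_trans (sparse W _)) // ltn_mul2r W1 /=.
set W' := W :\ v.
have W'W : W' \subset W by apply: subD1set.
have [||f Pf] := IH W'.
- by move: leWn; rewrite (cardsD1 v W) vW.
- by move=> U UW; apply: sparse; apply: fintype.subset_trans UW W'W.
pose N := [set w in W' | [set v; w] \in short_pairs W].
have N_D : #|N| <= D.
  apply: leq_trans degv; rewrite -(@card_in_imset _ _ (fun w => [set v; w]) N).
    apply/subset_leq_card/fintype.subsetP => _ /imsetP[w + ->].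
    by rewrite inE => /andP[_ wN]; rewrite inE wN set21.
  move=> w w'; rewrite !inE => /andP[/andP[wv _] _] /andP[/andP[w'v _] _] eq.
  have := set22 v w; rewrite eq !inE => /orP[/eqP wE|/eqP//].
  by rewrite wE eqxx in wv.
have [j jN] : exists j, j \notin f @: N.
  apply/existsP; rewrite -negb_forall; apply/negP => /forallP all.
  have : #|[set: 'I_D.+1]| <= #|f @: N|.
    by apply/subset_leq_card/fintype.subsetP => j _; apply: all.
  rewrite cardsT card_ord leqNgt => /negP[].
  by rewrite ltnS; apply: leq_trans (leq_imset_card _ _) N_D.
exists (fun x => if x == v then j else f x) => e i eE.
have /orP P := Pf e i eE.
set big := [set x in e :&: W' | f x != i] in P.
set cls := [set x in e :&: W' | f x == i] in P.
have card_clsbig : #|cls| + #|big| = #|e :&: W'| by apply: card_split.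
have rest_sub : big \subset
    [set x in e :&: W | (if x == v then j else f x) != i].
  by apply/fintype.subsetP => x; rewrite !inE => /andP[/and3P[-> /negPf-> ->]].
have rest : 1 < #|big| -> peelable W (fun x => if x == v then j else f x) e i.
  move=> big1; apply/orP; right.
  exact: leq_trans big1 (subset_leq_card rest_sub).
(* Two points outside class [i] persist when [v] is added. Otherwise class and complement each have
   at most one point of [e :&: W'], so if [v] lies in [e] the trace on [W] has at most 3 points and
   [v] forms a short pair with each of the others. *)
have [/rest//|big1] := ltnP 1 #|big|.
have cls1 : #|cls| <= 1 by case: P => //; rewrite ltnNge big1.
apply/orP; left.
have [ve|ve] := boolP (v \in e); last first.
  apply: leq_trans cls1; apply/subset_leq_card/fintype.subsetP => x.
  rewrite !inE; have [->|_] := eqVneq x v; last by [].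
  by rewrite (negPf ve).
have eW3 : #|e :&: W| <= 3.
  rewrite (cardsD1 v) inE ve vW -setIDA -/W' -card_clsbig.
  by rewrite -[3]/(1 + (1 + 1)) leq_add2l leq_add.
have nbr x : x \in e -> x \in W -> x != v -> x \in N.
  move=> xe xW xv; rewrite !inE xv xW subUset !sub1set vW xW /=.
  rewrite cards2 [v == x]eq_sym xv /=; apply/existsP; exists e.
  by rewrite eE subUset !sub1set ve xe.
have [ij|ij] := eqVneq j i; last first.
  apply: leq_trans cls1; apply/subset_leq_card/fintype.subsetP => x.
  rewrite !inE; have [_|_] := eqVneq x v; last by [].
  by rewrite (negPf ij) andbF.
rewrite -(cards1 v); apply/subset_leq_card/fintype.subsetP => x.
rewrite !inE => /andP[/andP[xe xW]].
have [//|xv /eqP fx] := eqVneq x v.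
by case/negP: jN; rewrite ij -fx imset_f ?nbr.
Qed.

(** Removing the largest of [D.+1] classes leaves at most a fraction [D / D.+1] of the vertices, so
    the numerical hypothesis makes [m] rounds exhaust [W]. Classes peeled earlier get higher
    ranks. *)
Lemma ranking (D m : nat) W :
  (forall W', W' \subset W -> 2 * #|short_pairs W'| <= D * #|W'|) ->
  #|W| * D ^ m < D.+1 ^ m ->
  exists2 r : T -> nat, forall x, x \in W -> r x < m &
    forall e j, e \in E -> #|[set x in e :&: W | r x == j]| <= 1 \/
      1 < #|[set x in e :&: W | r x < j]|.
Proof.
elim: m => [|m IH] in W *; move=> sparse small.
  have W0 : W = set0.
    by apply/eqP; rewrite -cards_eq0 -leqn0 -ltnS; rewrite !expn0 muln1 in small.
  exists (fun=> 0) => [x|e j _]; first by rewrite W0 inE.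
  left; rewrite W0 setI0 (_ : [set x in set0 | _] = set0) ?cards0 //.
  by apply/setP => x; rewrite !inE.
have [f Pf] := @peelable_colouring D W sparse.
have [i big] : exists i, #|W| <= D.+1 * #|[set x in W | f x == i]|.
  apply/existsP; rewrite -[X in is_true X]negbK negb_exists; apply/negP => /forallP no.
  have : \sum_(i : 'I_D.+1) D.+1 * #|[set x in W | f x == i]| < D.+1 * #|W|.
    rewrite -[X in X * #|W|]card_ord -sum_nat_const.
    rewrite !big_ord_recl /= -addSn leq_add //; first by rewrite ltnNge no.
    by apply: leq_sum => k _; apply: ltnW; rewrite ltnNge no.
  rewrite -big_distrr /= ltn_mul2l /= ltnNge => /negP[].
  rewrite -[X in X <= _]sum1_card (partition_big f predT) //=.
  apply: leq_sum => k _; rewrite -sum1_card.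
  by under [X in _ <= X]eq_bigl => x do rewrite inE.
pose W' := [set x in W | f x != i].
have W'W : W' \subset W by apply/fintype.subsetP => x; rewrite inE => /andP[].
have W'card := card_split W (fun x => f x == i).
rewrite -/W' in W'card.
have [||r rm Pr] := IH W'.
- by move=> U UW; apply: sparse; apply: fintype.subset_trans UW W'W.
- have le : D.+1 * #|W'| <= D * #|W| by nia.
  rewrite -(ltn_pmul2l (ltn0Sn D)) -expnS; apply: leq_ltn_trans small.
  by rewrite expnS !mulnA [#|W| * D]mulnC leq_mul2r le orbT.
exists (fun x => if x \in W' then r x else m) => [x xW|e j eE].
  by case: ifP => // /rm /leqW.
(* Rank [m] is the class just peeled and all of [W'] lies below it, so [peelable] applies; other
   ranks are settled by the ranking of [W']. *)
have [->|jm] := eqVneq j m.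
  have := Pf e i eE; rewrite /peelable => /orP[P|P]; [left|right].
    apply: leq_trans P; apply/subset_leq_card/fintype.subsetP => x.
    rewrite inE => /andP[xeW]; rewrite inE xeW /=.
    case: ifP => [/rm rx|+ _]; first by rewrite (ltn_eqF rx).
    by move: xeW; rewrite !inE => /andP[_ ->] /= /negbFE.
  apply: leq_trans P _; apply/subset_leq_card/fintype.subsetP => x.
  rewrite inE => /andP[xeW fx]; rewrite inE xeW /=.
  suff xW' : x \in W' by rewrite xW' rm.
  by move: xeW; rewrite !inE fx => /andP[_ ->].
case: (Pr e j eE) => P; [left|right].
  apply: leq_trans P; apply/subset_leq_card/fintype.subsetP => x.
  rewrite inE => /andP[/setIP[xe _]]; case: ifP => [xW' rx|_].
    by rewrite inE inE xe xW'.
  by rewrite eq_sym (negPf jm).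
apply: leq_trans P _; apply/subset_leq_card/fintype.subsetP => x.
rewrite inE => /andP[/setIP[xe xW'] rx].
by rewrite inE inE xe xW' rx (fintype.subsetP W'W).
Qed.

(** * Colouring pairs by their ranks *)

(** Doubling frees the parity bit for the equality test, so the colour determines both data, and
    ranks below [m] give colours below [m.*2]. *)
Definition pair_colour (r : T -> nat) s :=
  (\max_(x in s) r x).*2 + [forall x in s, forall y in s, r x == r y].

(* With [b] the least rank such that two points of [e :|: f] have rank at most
   [b], the unique pair is the set of points of rank [b] if there are two of
   them, and the set of points of rank at most [b] otherwise. *)
Lemma unique_pair_colour (r : T -> nat) e f :
  (forall h j, h \in [set e; f] -> #|[set x in h | r x == j]| <= 1 \/
      1 < #|[set x in h | r x < j]|) ->
  1 < #|e :|: f| ->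
  exists2 s, s \in pairs (e :|: f) &
    forall s', s' \in pairs (e :|: f) ->
      pair_colour r s' = pair_colour r s -> s' = s.
Proof.
move=> good; set h := e :|: f => h2.
have low : exists j, 1 < #|[set x in h | r x <= j]|.
  exists (\max_(x in h) r x); rewrite (_ : [set x in h | _] = h) //.
  apply/setP => x; rewrite inE; case: (boolP (x \in h)) => //= xh.
  exact: leq_bigmax_cond.
case: (ex_minnP low) => b b2 bmin.
have below : #|[set x in h | r x < b]| <= 1.
  case: b bmin {b2} => [|b] bmin.
    rewrite (_ : [set x in h | _] = set0) ?cards0 //.
    by apply/setP => x; rewrite !inE andbF.
  by rewrite leqNgt; apply/negP => /bmin; rewrite ltnn.
(* By minimality of [b] at most one point lies below it, which rules out the second alternative of
   [good]. *)
have at_b g : g \in [set e; f] -> #|[set x in g | r x == b]| <= 1.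
  move=> gef; case: (good g b gef) => //; rewrite ltnNge => /negP[].
  apply: leq_trans below; apply/subset_leq_card/fintype.subsetP => x.
  rewrite !inE => /andP[xg ->]; rewrite andbT.
  by move: gef; rewrite !inE => /orP[] /eqP <-; rewrite xg ?orbT.
have hb2 : #|[set x in h | r x == b]| <= 2.
  apply: (@leq_trans #|[set x in e | r x == b] :|: [set x in f | r x == b]|).
    by apply/subset_leq_card/fintype.subsetP => x; rewrite !inE andb_orl.
  apply: leq_trans (leq_card_setU _ _) _.
  by rewrite -[2]/(1 + 1) leq_add // at_b ?set21 ?set22.
have pick_pair s : s \subset h -> #|s| = 2 ->
    (forall s', s' \in pairs h -> pair_colour r s' = pair_colour r s -> s' \subset s) ->
    exists2 s, s \in pairs h &
      forall s', s' \in pairs h -> pair_colour r s' = pair_colour r s -> s' = s.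
  move=> sh s2 sub; exists s; first by rewrite inE powersetE sh s2 eqxx.
  move=> s' s'h eq; apply/eqP; rewrite eqEcard sub //= s2.
  by move: s'h; rewrite inE => /andP[_ /eqP->].
have colour_inj s s' : pair_colour r s' = pair_colour r s ->
    \max_(x in s') r x = \max_(x in s) r x /\
    [forall x in s', forall y in s', r x == r y] =
      [forall x in s, forall y in s, r x == r y].
  rewrite /pair_colour; case: [forall x in s', _]; case: [forall x in s, _] => /=; lia.
have [hb1|hb1] := ltnP 1 #|[set x in h | r x == b]|.
  set s := [set x in h | r x == b] in hb1 hb2 *.
  have max_s : \max_(x in s) r x <= b.
    by apply/bigmax_leqP => x; rewrite inE => /andP[_ /eqP->].
  apply: (pick_pair s).
  - by apply/fintype.subsetP => x; rewrite inE => /andP[].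
  - by apply/eqP; rewrite eqn_leq hb2.
  (* A pair of the same colour has equal ranks with maximum [b], hence lies in level [b]. *)
  move=> s' s'h /colour_inj[max_s' const_s'].
  have const : [forall x in s', forall y in s', r x == r y].
    rewrite const_s'; apply/forall_inP => x; rewrite inE => /andP[_ /eqP->].
    by apply/forall_inP => y; rewrite inE => /andP[_ /eqP->].
  have [z zs'] : exists z, z \in s.
    by apply/set0Pn; rewrite -card_gt0 ltnW.
  have max_sb : \max_(x in s) r x = b.
    apply/eqP; rewrite eqn_leq max_s /=.
    by apply: leq_trans (leq_bigmax_cond _ zs'); move: zs'; rewrite inE => /andP[_ /eqP->].
  move: s'h; rewrite inE powersetE => /andP[s'h /eqP s'2].
  apply/fintype.subsetP => x xs'; rewrite inE (fintype.subsetP s'h) //=.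
  have [|y ys' maxE] := @eq_bigmax_cond _ (mem s') r; first by rewrite s'2.
  by rewrite -max_sb -max_s' maxE; exact: (forall_inP (forall_inP const x xs') y ys').
apply: (pick_pair [set x in h | r x <= b]).
- by apply/fintype.subsetP => x; rewrite inE => /andP[].
- apply/eqP; rewrite eqn_leq b2 andbT -[2]/(1 + 1).
  apply: leq_trans (leq_add below hb1); apply: leq_trans (leq_card_setU _ _).
  apply/subset_leq_card/fintype.subsetP => x.
  by rewrite !inE -andb_orr leq_eqVlt [(_ == _) || _]orbC.
(* Here the maximum alone suffices: only two points have rank at most [b]. *)
move=> s' s'h /colour_inj[max_s' _]; move: s'h; rewrite inE powersetE => /andP[s'h _].
have max_le : \max_(x in s') r x <= b.
  by rewrite max_s'; apply/bigmax_leqP => x; rewrite inE => /andP[].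
apply/fintype.subsetP => x xs'; rewrite inE (fintype.subsetP s'h) //=.
exact: leq_trans (leq_bigmax_cond _ xs') max_le.
Qed.

End Ranking.

(** * From rankings to colourings of the union hypergraph *)

Lemma union_colourable (T : finType) (H : hypergraph T) (m : nat) (r : T -> nat) :
  (forall x, x \in vertices H -> r x < m) ->
  (forall e j, e \in edges H ->
    #|[set x in e | r x == j]| <= 1 \/ 1 < #|[set x in e | r x < j]|) ->
  subset2_CF_colourable (union_hypergraph H) m.*2.
Proof.
move=> rm good.
have bound (s : vpair (union_hypergraph H)) : pair_colour r (val s) < m.*2.
  have := valP s; rewrite inE powersetE => /andP[sV /eqP s2].
  have [|y ys maxE] := @eq_bigmax_cond _ (mem (val s)) r; first by rewrite s2.
  have := rm y (fintype.subsetP sV y ys); rewrite /pair_colour maxE.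
  by case: [forall x in _, _]; lia.
apply/existsP; exists [ffun s => Ordinal (bound s)].
apply/forall_inP => h hE; apply/implyP => /ltnW h2.
have hV : h \subset vertices H.
  by rewrite -powersetE; apply: (fintype.subsetP (edges_sub (union_hypergraph H))).
case/imset2P: hE => e f eE fE hef; rewrite hef in h2 hV *.
have [|s sh us] := @unique_pair_colour T r e f _ h2.
  by move=> g j /set2P[] ->; apply: good.
have sV : s \in pairs (vertices H).
  by move: sh; rewrite !inE => /andP[/fintype.subset_trans-> // ->].
apply/existsP; exists (Sub s sV); rewrite SubK sh /=.
apply/forallP => s'; apply/implyP => /andP[s'h ne].
rewrite !ffunE -val_eqE /= eq_sym; apply: contraNN ne => /eqP eq.
by rewrite -val_eqE /= (us _ s'h eq).
Qed.

Lemma chi2_CF_le (T : finType) (H : hypergraph T) k :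
  subset2_CF_colourable H k -> chi2_CF H <= k.
Proof. by rewrite /chi2_CF; case: ex_minnP => m _ min /min. Qed.

Lemma chi2_CF_le1 (T : finType) (H : hypergraph T) :
  (forall h, h \in edges H -> #|h| <= 2) -> chi2_CF H <= 1.
Proof.
move=> small; apply: chi2_CF_le; apply/existsP; exists [ffun=> ord0].
by apply/forall_inP => h hE; apply/implyP; rewrite ltnNge small.
Qed.

(** * Sparsity of short pairs from the Delaunay hypothesis *)

Lemma mem_Del_induced (T : finType) (H : hypergraph T) (e S : {set T}) :
  e \in edges H -> #|e :&: S| = 2 -> e :&: S \in edges (Del (induced H S)).
Proof. by move=> eE eS2; rewrite inE eS2 eqxx andbT; apply/imsetP; exists e. Qed.

(** Count incidences of a short pair [s] with a subset [S] of [W] for which [s] is a Delaunay edge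
    of the trace on [S]; each [s] has at least [2 ^ #|W| / 8] of them. *)
Lemma short_pairs_double_count (T : finType) (H : hypergraph T) (W : {set T}) :
  #|short_pairs (edges H) W| * 2 ^ #|W| <=
    8 * \sum_(S in powerset W) #|edges (Del (induced H S))|.
Proof.
apply: (@leq_trans (\sum_(s in short_pairs (edges H) W)
    8 * #|[set S in powerset W | s \in edges (Del (induced H S))]|)).
  rewrite -sum_nat_const; apply: leq_sum => s; rewrite inE.
  rewrite inE powersetE => /andP[/andP[sW /eqP s2]].
  case/existsP=> e /andP[eE /andP[se e3]].
  apply: leq_trans (@card_restricting_subsets T W e s _ e3) _.
    by rewrite subsetI se sW.
  rewrite leq_mul2l /=; apply/subset_leq_card/fintype.subsetP => S.
  rewrite inE => /andP[SW /eqP eS]; rewrite inE SW -eS mem_Del_induced //.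
  by rewrite eS.
rewrite -big_distrr leq_mul2l /=.
under eq_bigr => s _.
  rewrite -sum1_card; under eq_bigl => S do rewrite inE.
  rewrite big_mkcondr; over.
rewrite exchange_big /=; apply: leq_sum => S _.
rewrite -big_mkcondr /= sum1_card; apply/subset_leq_card/fintype.subsetP => s.
by case/andP.
Qed.

Local Open Scope ring_scope.

Lemma short_pairs_sparse (R : realType) (T : finType) (H : hypergraph T)
    (c : R) (W : {set T}) :
  0 < c -> hereditary_linear_Delaunay c H -> W \subset vertices H ->
  #|short_pairs (edges H) W|%:R <= 8 * c * #|W|%:R.
Proof.
move=> c0 sparse WV.
have p0 : 0 < (2 ^ #|W|)%:R :> R by rewrite ltr0n expn_gt0.
rewrite -(ler_pM2r p0) -natrM.
apply: le_trans (_ : (8 * \sum_(S in powerset W) #|edges (Del (induced H S))|)%:R <= _).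
  by rewrite ler_nat short_pairs_double_count.
rewrite natrM -!mulrA ler_pM2l ?ltr0n // natr_sum.
apply: (@le_trans _ _ (\sum_(S in powerset W) (c * #|W|%:R))).
  apply: ler_sum => S; rewrite powersetE => SW.
  apply: le_trans (sparse S (fintype.subset_trans SW WV)) _.
  by rewrite ler_pM2l // ler_nat subset_leq_card.
by rewrite sumr_const card_powerset -[_ *+ _]mulr_natr -mulrA.
Qed.

(** * Number of rounds and the final bound *)

(** With [x = 1 / D.+1], the inequality [1 - x <= expR (- x)] gives [expR x <= D.+1 / D], while the
    hypothesis says that [n] is below the [m]-th power of [expR x]. *)
Lemma natr_exp_lt (R : realType) (n D m : nat) :
  (0 < D)%N -> D.+1%:R * ln n%:R < m%:R :> R -> (n * D ^ m < D.+1 ^ m)%N.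
Proof.
move=> D0 lnm; have [->|n0] := posnP n; first by rewrite mul0n expn_gt0.
have n0R : 0 < n%:R :> R by rewrite ltr0n.
have D0R : 0 < D%:R :> R by rewrite ltr0n.
have D1R : 0 < D.+1%:R :> R by rewrite ltr0n.
rewrite -(ltr_nat R) natrM !natrX.
have n_lt : n%:R < expR (D.+1%:R^-1) ^+ m :> R.
  rewrite -expRM_natr -[X in X < _](lnK n0R) ltr_expR.
  by rewrite mulrC ltr_pdivlMr // mulrC.
have D_le : expR (D.+1%:R^-1) * D%:R <= D.+1%:R :> R.
  have := expR_ge1Dx (- (D.+1%:R^-1) : R); rewrite expRN => le.
  rewrite mulrC -ler_pdivlMr ?expR_gt0 // mulrC -ler_pdivrMr //.
  rewrite (_ : _ / _ = 1 - D.+1%:R^-1) //.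
  by rewrite -natr1; field; rewrite natr1 gt_eqF.
apply: lt_le_trans (_ : expR (D.+1%:R^-1) ^+ m * D%:R ^+ m <= _).
  by rewrite ltr_pM2r // exprn_gt0.
by rewrite -exprMn lerXn2r // nnegrE ?mulr_ge0 // ?expR_ge0 // ltW.
Qed.

(* The maximum with 1 only matters in the degenerate range where
   c * ln |V| is small: if c < 1/2 the Delaunay hypothesis forces every edge
   of H to have at most one vertex, and then chi is 1 as soon as |V| >= 2
   (a function on a nonempty set needs a colour) while c * ln |V| can be
   arbitrarily close to 0. If 1/2 <= c and 2 <= |V| it is absorbed by C. *)
Theorem theorem1p5 (R : realType) :
  exists C : R, 0 < C /\
    forall (c : R) (T : finType) (H : hypergraph T),
      0 < c -> hereditary_linear_Delaunay c H ->
      (chi2_CF (union_hypergraph H))%:R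
        <= Num.max 1 (C * (c * ln (#|vertices H|%:R))).
Proof.
(* In the main range [D.+1 <= 16 * c + 2 <= 20 * c] and [1 <= 4 * (c * ln n)], so the [2 * m]
   colours number at most [2 * (20 + 4) * (c * ln n)]. *)
exists 48; split; first by rewrite ltr0n.
move=> c T H c0 sparse; rewrite le_max.
have edgeV e : e \in edges H -> e \subset vertices H.
  by rewrite -powersetE; apply: (fintype.subsetP (edges_sub H)).
have le1 : (forall e f, e \in edges H -> f \in edges H -> (#|e :|: f| <= 2)%N) ->
    (chi2_CF (union_hypergraph H))%:R <= 1 :> R.
  by move=> small; rewrite lern1 chi2_CF_le1 // => _ /imset2P[e f /small s /s ? ->].
have [n1|n2] := leqP #|vertices H| 1.
  rewrite le1 // => e f /edgeV eV /edgeV fV; apply: leq_trans (leqW n1).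
  by rewrite subset_leq_card // subUset eV.
have [c2|c2] := ltP c (1 / 2).
  rewrite le1 // => e f eE fE.
  have card1 g : g \in edges H -> (#|g| <= 1)%N.
    move=> gE; rewrite leqNgt; apply/negP => /card_gt1P[x [y [xg yg xy]]].
    (* Restricting to two points of [g] creates a Delaunay edge on two vertices, so [1 <= 2 * c], a
       contradiction. *)
    have gxy : g :&: [set x; y] = [set x; y].
      by apply/setIidPr; rewrite subUset !sub1set xg yg.
    have := @mem_Del_induced _ _ g [set x; y] gE; rewrite gxy cards2 xy.
    move=> /(_ erefl) xyD.
    have : [set x; y] \subset vertices H.
      by rewrite -gxy; apply: fintype.subset_trans (subsetIl _ _) (edgeV g gE).
    move=> /sparse; rewrite cards2 xy; apply/negP; rewrite -ltNge.
    apply: (@lt_le_trans _ _ 1); first by rewrite -[(true.+1)]/2%N; lra.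
    by rewrite ler1n; apply/card_gt0P; exists [set x; y].
  apply: leq_trans (leq_card_setU _ _) _.
  by rewrite -[2%N]/(1 + 1)%N leq_add // card1.
set n := #|vertices H| in n2 *; apply/orP; right.
have ln_n : 1 / 2 <= ln n%:R :> R.
  rewrite -ler_expR lnK ?posrE ?ltr0n ?(ltnW n2) //.
  apply: (@le_trans _ _ 2); last by rewrite ler_nat.
  have := expR_ge1Dx (- (1 / 2) : R); rewrite expRN => le.
  have e0 := expR_gt0 (1 / 2 : R).
  rewrite -[X in X <= _]invrK -[X in _ <= X]invrK lef_pV2 ?posrE ?invr_gt0 //; lra.
have c16 : 0 <= 16 * c by lra.
(* Twice the bound [8 * c * #|W|] on short pairs must be at most [D * #|W|]. *)
set D := (Num.truncn (16 * c)).+1.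
have D_le : D%:R <= 16 * c + 1.
  by rewrite /D -natr1 lerD2r; have /andP[] := truncn_itv c16.
have D_gt : 16 * c < D%:R by have /andP[] := truncn_itv c16.
have ln0 : 0 <= D.+1%:R * ln n%:R :> R by rewrite mulr_ge0 // ?ler0n //; lra.
set m := (Num.truncn (D.+1%:R * ln n%:R : R)).+1.
have m_gt : D.+1%:R * ln n%:R < m%:R :> R by have /andP[] := truncn_itv ln0.
have m_le : m%:R <= D.+1%:R * ln n%:R + 1 :> R.
  by rewrite /m -natr1 lerD2r; have /andP[] := truncn_itv ln0.
have [||r rm good] := @ranking T (edges H) D m (vertices H).
- move=> W WV; rewrite -(ler_nat R) !natrM.
  have := short_pairs_sparse c0 sparse WV => le.
  apply: (@le_trans _ _ (16 * c * #|W|%:R)); first by lra.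
  by rewrite ler_wpM2r // ltW.
- exact: natr_exp_lt m_gt.
have col : subset2_CF_colourable (union_hypergraph H) m.*2.
  apply: (@union_colourable _ _ _ r) => // e j eE.
  by have := good e j eE; rewrite (setIidPl (edgeV e eE)).
apply: (@le_trans _ _ m.*2%:R); first by rewrite ler_nat chi2_CF_le.
rewrite -muln2 natrM; move: m_le; rewrite -[D.+1%:R]natr1 => m_le.
have : (D%:R + 1) * ln n%:R <= 20 * c * ln n%:R by rewrite ler_wpM2r //; lra.
have : 1 / 4 <= c * ln n%:R by nra.
by nra.
Qed.
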